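(* Let $p=p(n)\in(0,1]$ satisfy $p\gg \log(n)/n$, i.e. $pn/\log n\to\infty$ as $n\to\infty$, and let $G\sim G(n,p)$ be an Erdős–Rényi random graph. Consider the pull voter model with agnostic nodes on $G$ (either synchronous or asynchronous) in which each vertex selects uniformly at random among its neighbours, started from a configuration with at least one gnostic vertex. Let $T_a$ be the number of rounds it takes for the agnostic vertices to disappear. Then, with high probability (over $G$, i.e. with probability tending to $1$ as $n\to\infty$), $$\mathbb{E}[T_a]=O\big(f(n)\log n\big),$$ where the expectation is over the voter process on the given graph $G$, and $f(n)=1$ in the synchronous case and $f(n)=n$ in the asynchronous case.
   Context: $G(n,p)$ is the random graph on $n$ vertices in which each pair of vertices is joined by an edge independently with probability $p$. Pull voter model with agnostic nodes (uniform selection). Each node is, at each time, either agnostic (no colour) or gnostic (with a colour). In the synchronous version, at each round every node $v$ independently selects a neighbour $u$ uniformly at random. If $u$ is agnostic, $v$ keeps its current state; if $u$ is gnostic, $v$ copies the colour of $u$ (and is then gnostic). All updates use the states at the start of the round and occur simultaneously. In the asynchronous version, at each round one node $v$ is chosen uniformly at random from the vertex set, it alone selects a uniformly random neighbour and updates by the same rule. Gnostic nodes never become agnostic again. $T_a$ is the first time at which no node is agnostic. *)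

(* Defs.v *)
(* MathComp / MathComp-Analysis *)
From HB Require Import structures.
From mathcomp Require Export all_boot all_order all_algebra.
From mathcomp Require Export all_classical all_reals all_analysis.
Export Order.TTheory GRing.Theory Num.Theory.
Export numFieldNormedType.Exports.
Set Implicit Arguments.
Unset Strict Implicit.
Unset Printing Implicit Defensive.

Local Open Scope classical_set_scope.
Local Open Scope ring_scope.

(* A graph on 'I_n is given by its edge set, a set of unordered pairs. *)
Definition vertex_pairs (n : nat) : {set {set 'I_n}} :=
  [set a : {set 'I_n} | #|a| == 2%N]%SET.

Definition adj (n : nat) (E : {set {set 'I_n}}) : rel 'I_n :=
  fun i j => [set i; j]%SET \in E.

Definition gnp_weight (R : realType) (n : nat) (p : R) (E : {set {set 'I_n}}) : R :=
  \prod_(a in vertex_pairs n) (if a \in E then p else 1 - p).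

Definition gnp_prob (R : realType) (n : nat) (p : R)
    (A : {set {set 'I_n}} -> Prop) : R :=
  \sum_(E in powerset (vertex_pairs n) | `[< A E >]) gnp_weight p E.

Definition neighbours (V : finType) (e : rel V) (v : V) : {set V} :=
  [set u | e v u]%SET.

(* Probability that v selects u. A vertex without neighbours selects itself
   (hence keeps its state), so that the process is defined on every graph. *)
Definition selection_prob (R : realType) (V : finType) (e : rel V) (v u : V) : R :=
  if neighbours e v == finset.set0 then (u == v)%:R
  else (u \in neighbours e v)%:R / #|neighbours e v|%:R.

(* A state is [None] for an agnostic node, [Some c] for a gnostic one. *)
Definition pull (V C : Type) (x : V -> option C) (v u : V) : option C :=
  if x u is Some c then Some c else x v.

Definition discrete_rv (d : measure_display) (Omega : measurableType d)
    (T : finType) (Y : Omega -> T) : Prop :=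
  forall u : T, measurable (Y @^-1` [set u]).

Definition mutually_independent (d : measure_display) (Omega : measurableType d)
    (R : realType) (P : probability Omega R) (I : choiceType) (T : finType)
    (Y : I -> Omega -> T) : Prop :=
  forall (J : seq I) (B : I -> set T), uniq J ->
    P (\bigcap_(i in [set` J]) (Y i @^-1` B i))
      = (\prod_(i <- J) P (Y i @^-1` B i))%E.

(* [S (t, v)] is the neighbour selected by v in round t. *)
Definition synchronous_voter (d : measure_display) (Omega : measurableType d)
    (R : realType) (P : probability Omega R) (V : finType) (C : Type)
    (e : rel V) (x0 : V -> option C) (X : nat -> Omega -> V -> option C) : Prop :=
  exists S : nat * V -> Omega -> V,
    [/\ forall i, discrete_rv (S i),
        mutually_independent P S,
        forall t v u, P (S (t, v) @^-1` [set u]) = (selection_prob R e v u)%:E,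
        forall w v, X 0%N w v = x0 v
      & forall t w v, X t.+1 w v = pull (X t w) v (S (t, v) w)].

(* [S t] is the pair formed of the vertex activated in round t and of the
   neighbour that it selects. *)
Definition asynchronous_voter (d : measure_display) (Omega : measurableType d)
    (R : realType) (P : probability Omega R) (V : finType) (C : Type)
    (e : rel V) (x0 : V -> option C) (X : nat -> Omega -> V -> option C) : Prop :=
  exists S : nat -> Omega -> V * V,
    [/\ forall t, discrete_rv (S t),
        mutually_independent P S,
        forall t v u, P (S t @^-1` [set (v, u)])
                        = (#|V|%:R^-1 * selection_prob R e v u)%:E,
        forall w v, X 0%N w v = x0 v
      & forall t w v, X t.+1 w v =
          if v == (S t w).1 then pull (X t w) v (S t w).2 else X t w v].

Inductive schedule := Synchronous | Asynchronous.

Definition voter_process (s : schedule) :=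
  match s with
  | Synchronous => synchronous_voter
  | Asynchronous => asynchronous_voter
  end.

Definition time_scale (R : realType) (s : schedule) (n : nat) : R :=
  match s with Synchronous => 1 | Asynchronous => n%:R end.

(* +oo (the infimum of the empty set) if some node is agnostic at all times. *)
Definition agnostic_time (R : realType) (Omega : Type) (V : finType) (C : Type)
    (X : nat -> Omega -> V -> option C) (w : Omega) : \bar R :=
  ereal_inf [set (t%:R)%:E | t in [set t : nat | forall v, X t w v <> None]].

(* The bound holds for each initial configuration with a gnostic vertex and each
   realization of the process on a probability space. *)
Definition expected_agnostic_time_le (R : realType) (s : schedule) (V : finType)
    (C : Type) (e : rel V) (b : R) : Prop :=
  forall (d : measure_display) (Omega : measurableType d)
    (P : probability Omega R) (x0 : V -> option C)
    (X : nat -> Omega -> V -> option C),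
    (exists v, x0 v <> None) -> voter_process s P e x0 X ->
    (\int[P]_w agnostic_time R X w <= b%:E)%E.

(* Main.v *)
Require Import Defs.
From mathcomp Require Import ring lra measurable_realfun.
Set Implicit Arguments.
Unset Strict Implicit.
Unset Printing Implicit Defensive.
Local Open Scope classical_set_scope.
Local Open Scope ring_scope.

(* Exponential Markov inequalities and a union bound show that, with high
   probability, every degree of [G(n, p)] lies between [D / 4] and [4 D], where
   [D = p (n - 1)], and every cut [(A, ~A)] has at least [p |A| (n - |A|) / 4]
   edges.  On such a graph the potential [1 / k - 1 / n], where [k] is the number
   of gnostic vertices, is multiplied in expectation by at most [1 - c / f(n)] in
   each round: the number of new gnostic vertices has mean [m] at least of order
   [k (n - k) / (n f(n))] and second moment [O(k m)], so that the convexity of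
   [1 / k] costs only a constant factor.  Since [n^2] times the potential is at
   least [1] as long as a vertex is agnostic, [P(T_a > t) <= n^2 (1 - c / f(n))^t],
   and summing over [t] gives [O(f(n) log n)]. *)

(** * Edge counts in the random graph *)

(** The generating function of the number of edges inside [F]: pairs are present independently, and
    each pair of [F] contributes the factor [1 - p + p * y]. *)
Lemma sum_gnp_weight_exp (R : realType) (n : nat) (p y : R)
    (F : {set {set 'I_n}}) : F \subset vertex_pairs n ->
  \sum_(E in powerset (vertex_pairs n)) gnp_weight p E * y ^+ #|F :&: E|%SET
    = (1 + p * (y - 1)) ^+ #|F|.
Proof.
move=> sF.
(* [f a] is the factor of a pair that belongs to [E], [g a] that of a pair that does not. With
   [f a = 0] off [vertex_pairs n], the expanded product loses every [E] that is not a set of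
   pairs. *)
pose f (a : {set 'I_n}) : R :=
  if a \in vertex_pairs n then p * (if a \in F then y else 1) else 0.
pose g (a : {set 'I_n}) : R := if a \in vertex_pairs n then 1 - p else 1.
transitivity (\prod_a (f a + g a)).
  rewrite bigA_distr big_mkcond /=; apply: eq_bigr => E _.
  rewrite powersetE; case: ifPn => [sE|]; last first.
    move=> /subsetPn[a aE aV]; rewrite (bigD1 a)//= aE /f (negbTE aV).
    by rewrite mul0r.
  rewrite /gnp_weight big_mkcond/= -prodr_const.
  rewrite [X in _ * X]big_mkcond/= -big_split/=.
  apply: eq_bigr => a _; rewrite finset.in_setI /f /g.
  have := fintype.subsetP sE a; have := fintype.subsetP sF a.
  case: (a \in vertex_pairs n); case: (a \in E); case: (a \in F) => //=;
    rewrite ?mulr1 ?mul1r//.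
    by move=> /(_ isT).
  by move=> _ /(_ isT).
rewrite -prodr_const [RHS]big_mkcond/=; apply: eq_bigr => a _.
rewrite /f /g; have := fintype.subsetP sF a.
case: (a \in vertex_pairs n); case: (a \in F) => //=; first by move=> _; ring.
- by move=> _; ring.
- by move=> /(_ isT).
- by rewrite add0r.
Qed.

Lemma gnp_weight_ge0 (R : realType) (n : nat) (p : R) (E : {set {set 'I_n}}) :
  0 <= p <= 1 -> 0 <= gnp_weight p E.
Proof.
move=> /andP[p0 p1]; apply: prodr_ge0 => a _; case: ifP => _ //.
by rewrite subr_ge0.
Qed.

(** Markov's inequality for [b * y ^+ #|F :&: E|], followed by [1 + x <= expR x]. Taking [y < 1]
    yields lower tails, [y > 1] upper tails. *)
Lemma gnp_prob_chernoff (R : realType) (n : nat) (p y b : R)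
    (F : {set {set 'I_n}}) (A : {set {set 'I_n}} -> Prop) :
  0 <= p <= 1 -> 0 <= y -> 0 <= b -> F \subset vertex_pairs n ->
  (forall E, A E -> 1 <= b * y ^+ #|F :&: E|%SET) ->
  gnp_prob p A <= b * expR (p * (y - 1) * #|F|%:R).
Proof.
move=> p01 y0 b0 sF hA; have /andP[p0 p1] := p01.
apply: (@le_trans _ _ (b * (1 + p * (y - 1)) ^+ #|F|)).
  rewrite -(sum_gnp_weight_exp p y sF) mulr_sumr /gnp_prob [leLHS]big_mkcondr /=.
  apply: ler_sum => E _; have w0 := gnp_weight_ge0 E p01.
  case: ifPn => [/asboolP/hA h|_]; last by rewrite !mulr_ge0// exprn_ge0.
  by rewrite mulrCA ler_peMr.
rewrite ler_wpM2l// expRM_natr lerXn2r ?nnegrE ?expR_ge0// ?expR_ge1Dx//.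
nra.
Qed.

Lemma gnp_prob_setT (R : realType) (n : nat) (p : R) :
  gnp_prob p (fun _ : {set {set 'I_n}} => True) = 1.
Proof.
rewrite /gnp_prob; under eq_bigl do rewrite asboolT// andbT.
have := @sum_gnp_weight_exp R n p 1 finset.set0 (finset.sub0set _).
rewrite finset.cards0 expr0 => <-; apply: eq_bigr => E _.
by rewrite finset.set0I finset.cards0 expr0 mulr1.
Qed.

Lemma gnp_prob_ge0 (R : realType) (n : nat) (p : R)
    (A : {set {set 'I_n}} -> Prop) : 0 <= p <= 1 -> 0 <= gnp_prob p A.
Proof. by move=> p01; apply: sumr_ge0 => E _; apply: gnp_weight_ge0. Qed.

Lemma gnp_prob_compl (R : realType) (n : nat) (p : R)
    (A : {set {set 'I_n}} -> Prop) :
  gnp_prob p A + gnp_prob p (fun E => ~ A E) = 1.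
Proof.
rewrite -(gnp_prob_setT n p) /gnp_prob [RHS](bigID (fun E => `[< A E >])) /=.
congr (_ + _); apply: eq_bigl => E; first by rewrite (asboolT I) andbT.
by rewrite (asboolT I) andbT asbool_neg.
Qed.

Lemma gnp_prob_mono (R : realType) (n : nat) (p : R)
    (A B : {set {set 'I_n}} -> Prop) : 0 <= p <= 1 ->
  (forall E : {set {set 'I_n}}, E \subset vertex_pairs n -> A E -> B E) ->
  gnp_prob p A <= gnp_prob p B.
Proof.
move=> p01 AB; rewrite /gnp_prob !big_mkcondr; apply: ler_sum => /= E.
rewrite powersetE => sE; have w0 := gnp_weight_ge0 E p01.
by case: asboolP => [/(AB _ sE) BE|_]; [rewrite asboolT | case: ifP].
Qed.

Lemma gnp_prob_exists (R : realType) (n : nat) (p : R) (I : finType) (P : pred I)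
    (A : I -> {set {set 'I_n}} -> Prop) : 0 <= p <= 1 ->
  gnp_prob p (fun E => exists2 i, P i & A i E)
    <= \sum_(i | P i) gnp_prob p (A i).
Proof.
move=> p01; rewrite /gnp_prob; under [leRHS]eq_bigr do rewrite big_mkcondr.
rewrite exchange_big big_mkcondr /=; apply: ler_sum => E _.
have w0 := gnp_weight_ge0 E p01.
case: asboolP => [[i Pi AE]|_]; last by apply: sumr_ge0 => i _; case: ifP.
rewrite (bigD1 i)//= asboolT// lerDl; apply: sumr_ge0 => j _.
by case: ifP.
Qed.

Definition cut (n : nat) (A : {set 'I_n}) : {set {set 'I_n}} :=
  [set [set i; j]%SET | i in A, j in ~: A]%SET.

Lemma cut_vertex_pairs (n : nat) (A : {set 'I_n}) : cut A \subset vertex_pairs n.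
Proof.
apply/fintype.subsetP => a /imset2P[i j iA]; rewrite !inE => jA ->.
by rewrite cards2; case: (eqVneq i j) jA => // <-; rewrite iA.
Qed.

(** A pair across the cut has exactly one end in [A], so [(i, j)] can be recovered from [[set i; j]]
    and the sum can be reindexed. *)
Lemma sum_cut (n : nat) (A : {set 'I_n}) (G : {set 'I_n} -> nat) :
  (\sum_(a in cut A) G a = \sum_(j in ~: A) \sum_(i in A) G [set i; j]%SET)%N.
Proof.
rewrite exchange_big /= pair_big_dep /= /cut curry_imset2X big_imset /=.
  by apply: eq_big => -[i j] //=; rewrite !inE.
move=> [i j] [k l]; rewrite !inE /= => /andP[iA jA] /andP[kA lA] /setP eq.
have := eq i; have := eq j; rewrite !inE !eqxx orbT /= => /esym hj /esym hi.
congr pair.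
  by case/orP: hi => /eqP // il; rewrite il (negbTE lA) in iA.
by case/orP: hj => /eqP // jk; rewrite jk kA in jA.
Qed.

Lemma card_cut (n : nat) (A : {set 'I_n}) : #|cut A| = (#|A| * #|~: A|%SET)%N.
Proof.
rewrite -sum1_card sum_cut; under eq_bigr do rewrite sum1_card.
by rewrite sum_nat_const mulnC.
Qed.

Lemma card_cut_edges (n : nat) (E : {set {set 'I_n}}) (A : {set 'I_n}) :
  #|cut A :&: E|%SET
    = (\sum_(v in ~: A) #|neighbours (adj E) v :&: A|%SET)%N.
Proof.
have -> : #|cut A :&: E|%SET = (\sum_(a in cut A) (a \in E))%N.
  by rewrite -sum1_card big_mkcond [RHS]big_mkcond; apply: eq_bigr => a _;
    rewrite !inE; do 2 case: (_ \in _).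
rewrite sum_cut; apply: eq_bigr => v _.
rewrite -sum1_card big_mkcond [RHS]big_mkcond; apply: eq_bigr => u _.
by rewrite !inE /adj finset.setUC; do 2 case: (_ \in _).
Qed.

(* [D] plays the role of the expected degree [p (n - 1)]. *)
Definition near_regular (R : realType) (V : finType) (e : rel V) (D : R) : Prop :=
  [/\ symmetric e,
      forall v, D / 4 <= #|neighbours e v|%:R <= 4 * D
    & forall A : {set V}, D / (4 * #|V|%:R) * #|A|%:R * #|~: A|%SET%:R
        <= (\sum_(v in ~: A) #|neighbours e v :&: A|%SET)%:R ].

(** The binomial theorem, sorted by subsets instead of sizes; it evaluates the union bound over all
    cuts. *)
Lemma sum_expr_card (R : realType) (T : finType) (z : R) :
  \sum_(A : {set T}) z ^+ #|A| = (1 + z) ^+ #|T|.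
Proof.
have -> : (1 + z) ^+ #|T| = \prod_(i : T) (z + 1) by rewrite prodr_const addrC.
rewrite bigA_distr; apply: eq_bigr => A _.
by rewrite -prodr_const big_mkcond.
Qed.

(** The square root of [expR 1] is at most [2], because [expR (- (1 / 2)) >= 1 / 2]. *)
Lemma expR1_le4 (R : realType) : expR 1 <= 4 :> R.
Proof.
have h2 : 1 / 2 <= expR (- (1 / 2)) :> R.
  by apply: le_trans (expR_ge1Dx _); lra.
have -> : expR 1 = expR (1 / 2) * expR (1 / 2) :> R by rewrite -expRD; congr expR; lra.
rewrite expRN in h2; set h := expR _ in h2 *.
have h0 : 0 < h by exact: expR_gt0.
have : h <= 2 by have := ler_pM2l h0 (1 / 2) h^-1; rewrite divff ?gt_eqF// h2; lra.
nra.
Qed.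

(** Exponential Markov with [y = expR (- 1) <= 1 / 2]: the exponent is at most [p / 4 - p / 2] times
    [#|F|]. *)
Lemma gnp_prob_few_edges (R : realType) (n : nat) (p : R) (F : {set {set 'I_n}}) :
  0 <= p <= 1 -> F \subset vertex_pairs n ->
  gnp_prob p (fun E => #|F :&: E|%SET%:R < p / 4 * #|F|%:R)
    <= expR (- (p / 4 * #|F|%:R)).
Proof.
move=> p01 sF; have /andP[p0 p1] := p01.
have e1 : expR (- 1) <= 1 / 2 :> R.
  have -> : 1 / 2 = 2^-1 :> R by rewrite mul1r.
  by rewrite expRN lef_pV2 ?posrE ?expR_gt0// (le_trans _ (expR_ge1Dx 1)).
have := @gnp_prob_chernoff R n p (expR (- 1)) (expR (p / 4 * #|F|%:R)) F
  (fun E => #|F :&: E|%SET%:R < p / 4 * #|F|%:R) p01 (expR_ge0 _) (expR_ge0 _) sF.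
move=> /(_ _)/le_trans; apply.
  move=> E hE; rewrite -expRM_natr -expRD -[leLHS]expR0 ler_expR; lra.
rewrite -expRD ler_expR.
have : 0 <= p * #|F|%:R by rewrite mulr_ge0.
nra.
Qed.

(** Exponential Markov with [y = expR 1 <= 4]: the exponent is at most [- 4 * p + 3 * p] times
    [#|F|]. *)
Lemma gnp_prob_many_edges (R : realType) (n : nat) (p : R) (F : {set {set 'I_n}}) :
  0 <= p <= 1 -> F \subset vertex_pairs n ->
  gnp_prob p (fun E => 4 * p * #|F|%:R < #|F :&: E|%SET%:R)
    <= expR (- (p * #|F|%:R)).
Proof.
move=> p01 sF; have /andP[p0 p1] := p01.
have e4 := expR1_le4 R.
have := @gnp_prob_chernoff R n p (expR 1) (expR (- (4 * p * #|F|%:R))) F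
  (fun E => 4 * p * #|F|%:R < #|F :&: E|%SET%:R) p01 (expR_ge0 _) (expR_ge0 _) sF.
move=> /(_ _)/le_trans; apply.
  move=> E hE; rewrite -expRM_natr -expRD -[leLHS]expR0 ler_expR; lra.
rewrite -expRD ler_expR.
have : 0 <= p * #|F|%:R by rewrite mulr_ge0.
nra.
Qed.

Lemma adj_sym (n : nat) (E : {set {set 'I_n}}) : symmetric (adj E).
Proof. by move=> i j; rewrite /adj finset.setUC. Qed.

Lemma adj_irrefl (n : nat) (E : {set {set 'I_n}}) :
  E \subset vertex_pairs n -> irreflexive (adj E).
Proof.
move=> /fintype.subsetP sE i; rewrite /adj finset.setUid.
by apply/negP => /sE; rewrite inE cards1.
Qed.

(** Degrees are cuts around single vertices, so the lower bound on degrees comes with the bound on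
    cuts. *)
Lemma card_neighbours_adj (n : nat) (E : {set {set 'I_n}}) (v : 'I_n) :
  E \subset vertex_pairs n ->
  #|neighbours (adj E) v| = #|cut (~: [set v]) :&: E|%SET.
Proof.
move=> sE; rewrite card_cut_edges finset.setCK big_set1; congr #|pred_of_set _|.
by apply/setP => u; rewrite !inE; case: eqVneq => [->|_]; rewrite ?andbT// adj_irrefl.
Qed.

Lemma card_cut_compl1 (n : nat) (v : 'I_n) : #|cut (~: [set v])%SET| = n.-1.
Proof.
by rewrite card_cut finset.setCK cards1 muln1 cardsC1 card_ord.
Qed.

Lemma expR_le1Dx2 (R : realType) (x : R) : 0 <= x <= 1 / 2 -> expR x <= 1 + 2 * x.
Proof.
move=> /andP[x0 x1]; have := expR_ge1Dx (- x); rewrite expRN => h.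
have e0 := expR_gt0 x.
have : (1 - x) * expR x <= 1.
  by have := ler_pM2r e0 (1 - x) (expR x)^-1; rewrite mulVf ?gt_eqF// h.
nra.
Qed.

Lemma near_regular_adj (R : realType) (n : nat) (p : R) (E : {set {set 'I_n}}) :
  0 <= p -> E \subset vertex_pairs n ->
  ~ (exists2 A, (A != finset.set0) && (~: A != finset.set0)%SET
       & #|cut A :&: E|%SET%:R < p / 4 * #|cut A|%:R) ->
  ~ (exists2 v, xpredT v & 4 * p * #|cut (~: [set v])%SET|%:R
       < #|cut (~: [set v]) :&: E|%SET%:R) ->
  near_regular (adj E) (p * n.-1%:R).
Proof.
move=> p0 sE few many.
have cutE (A : {set 'I_n}) :
    p / 4 * (#|A|%:R * #|~: A|%SET%:R) <= #|cut A :&: E|%SET%:R.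
  have [->|A0] := eqVneq A finset.set0; first by rewrite finset.cards0 mul0r mulr0.
  have [->|A1] := eqVneq (~: A)%SET finset.set0.
    by rewrite finset.cards0 !mulr0.
  rewrite leNgt; apply/negP => h; apply: few; exists A; first by rewrite A0 A1.
  by rewrite card_cut natrM.
split; first exact: adj_sym.
- move=> v; rewrite (card_neighbours_adj v sE); apply/andP; split.
    have := cutE (~: [set v])%SET; rewrite finset.setCK cards1 cardsC1 card_ord; lra.
  rewrite leNgt; apply/negP => h; apply: many; exists v => //.
  by rewrite card_cut_compl1 -mulrA.
(* The factor [p / 4] is weakened to [D / (4 n)] with [D = p (n - 1)], at the cost of
   [(n - 1) / n <= 1]. *)
- move=> A; rewrite -card_cut_edges; apply: le_trans (cutE A).
  rewrite -[leLHS]mulrA ler_wpM2r ?mulr_ge0// card_ord.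
  rewrite invfM mulrA mulrAC ler_wpM2r// -mulrA ler_piMr//.
  case: n {E sE few many cutE A} => [|n]; first by rewrite mul0r.
  by rewrite ler_pdivrMr ?ltr0n// mul1r ler_nat.
Qed.

(** The failure probability [5 / n] is made of [4 / n] for a cut with too few edges and [1 / n] for
    a vertex of too large degree. *)
Lemma gnp_prob_near_regular (R : realType) (n : nat) (p : R) :
  (1 < n)%N -> 0 <= p <= 1 -> 16 * ln n%:R <= p * n%:R ->
  1 - 5 / n%:R
    <= gnp_prob p (fun E : {set {set 'I_n}} => near_regular (adj E) (p * n.-1%:R)).
Proof.
move=> n1 p01 hln; have /andP[p0 p1] := p01.
have n0 : 0 < n%:R :> R by rewrite ltr0n (ltn_trans _ n1).
have n2 : 2 <= n%:R :> R by rewrite ler_nat.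
pose few (A : {set 'I_n}) (E : {set {set 'I_n}}) :=
  #|cut A :&: E|%SET%:R < p / 4 * #|cut A|%:R.
pose many (v : 'I_n) (E : {set {set 'I_n}}) :=
  4 * p * #|cut (~: [set v])%SET|%:R < #|cut (~: [set v]) :&: E|%SET%:R.
pose PA (A : {set 'I_n}) := (A != finset.set0) && (~: A != finset.set0)%SET.
have lnn : expR (- (2 * ln n%:R)) = (n%:R ^+ 2)^-1 :> R.
  by rewrite expRN mulrC expRM_natr lnK.
have nn : n%:R * (n%:R ^+ 2)^-1 = n%:R^-1 :> R.
  by rewrite expr2 invfM mulrA divff ?gt_eqF// mul1r.
have Pfew : \sum_(A | PA A) gnp_prob p (few A) <= 4 / n%:R.
  pose z : R := expR (- (p * n%:R / 8)).
  have z0 : 0 < z by exact: expR_gt0.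
  have zn : (1 + z) ^+ n - 1 <= 2 / n%:R.
    have hz : n%:R * z <= n%:R^-1.
      rewrite -nn ler_pM2l// -lnn ler_expR; lra.
    have h1 : (1 + z) ^+ n <= expR (n%:R * z).
      rewrite mulrC expRM_natr lerXn2r ?nnegrE ?expR_ge0 ?expR_ge1Dx//; lra.
    have h2 : n%:R^-1 <= 1 / 2 :> R by rewrite mul1r lef_pV2 ?posrE.
    have h3 : expR (n%:R * z) <= 1 + 2 * (n%:R * z).
      by apply: expR_le1Dx2; rewrite mulr_ge0 ?(ltW z0)//=; lra.
    lra.
  (* Used for the identity and for the complement, since either side of a cut may be the smaller
     one. The term of the empty set is the [1] subtracted in [zn]. *)
  have sumz (f : {set 'I_n} -> {set 'I_n}) : bijective f ->
      \sum_(A | f A != finset.set0) z ^+ #|f A| <= 2 / n%:R.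
    move=> bf; apply: le_trans zn.
    have <- : \sum_(A : {set 'I_n}) z ^+ #|A| = (1 + z) ^+ n.
      by rewrite sum_expr_card card_ord.
    rewrite [X in _ <= X - _](reindex f) /=; last exact: onW_bij.
    have [g fK gK] := bf.
    rewrite [X in _ <= X - _](bigD1 (g finset.set0))//= gK finset.cards0 expr0.
    rewrite addrC addrK; rewrite le_eqVlt; apply/orP; left; apply/eqP/eq_bigl => A.
    by rewrite -(can_eq gK (f A)) fK.
  have -> : 4 / n%:R = 2 / n%:R + 2 / n%:R :> R by lra.
  apply: le_trans (lerD (sumz id _) (sumz (@finset.setC _) _)); last 2 first.
  - exact: inv_bij.
  - exact/inv_bij/finset.setCK.
  rewrite 2!(big_mkcond (fun A => _ != _)) -big_split big_mkcond /=.
  apply: ler_sum => A _; rewrite /PA.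
  have zz (B : {set 'I_n}) : 0 <= z ^+ #|B| by rewrite exprn_ge0// ltW.
  case: eqVneq => _ /=; first by rewrite add0r; case: ifP.
  case: eqVneq => _ /=; first by rewrite addr0.
  apply: le_trans (gnp_prob_few_edges p01 (cut_vertex_pairs A)) _.
  have hC : #|A|%:R + #|~: A|%SET%:R = n%:R :> R.
    by rewrite -natrD cardsC card_ord.
  rewrite card_cut natrM.
  have a0 : 0 <= #|A|%:R :> R by [].
  have b0 : 0 <= #|~: A|%SET%:R :> R by [].
  have [hle|hle] := leP (#|A|%:R : R) #|~: A|%SET%:R.
    apply: ler_wpDr => //; rewrite -expRM_natr ler_expR -hC.
    have : 0 <= p * #|A|%:R by rewrite mulr_ge0.
    nra.
  apply: ler_wpDl => //; rewrite -expRM_natr ler_expR -hC.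
  have : 0 <= p * #|~: A|%SET%:R by rewrite mulr_ge0.
  nra.
have Pmany : \sum_(v | xpredT v) gnp_prob p (many v) <= 1 / n%:R.
  apply: (@le_trans _ _ (\sum_(v : 'I_n) (n%:R ^+ 2)^-1)).
    apply: ler_sum => v _.
    apply: le_trans (gnp_prob_many_edges p01 (cut_vertex_pairs _)) _.
    rewrite card_cut_compl1 -lnn ler_expR -subn1 natrB 1?ltnW//.
    nra.
  by rewrite sumr_const card_ord -[leLHS]mulr_natl nn mul1r.
have := gnp_prob_compl p (fun E : {set {set 'I_n}} => near_regular (adj E) (p * n.-1%:R)).
suff : gnp_prob p (fun E : {set {set 'I_n}} => ~ near_regular (adj E) (p * n.-1%:R))
    <= 5 / n%:R by lra.
apply: (@le_trans _ _ (4 / n%:R + 1 / n%:R)); last by lra.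
apply: le_trans (lerD Pfew Pmany).
apply: le_trans (lerD (gnp_prob_exists PA few p01) (gnp_prob_exists xpredT many p01)).
(* The two kinds of failure are indexed by a boolean, so that the union bound for families applies
   to them too. *)
have := gnp_prob_exists (I := bool) xpredT
  (fun b E => if b then exists2 A, PA A & few A E
              else exists2 v, xpredT v & many v E) p01.
rewrite big_bool; apply: le_trans.
apply: gnp_prob_mono => // E sE hE.
have [hf|hf] := pselect (exists2 A, PA A & few A E); first by exists true.
have [hm|hm] := pselect (exists2 v, xpredT v & many v E); first by exists false.
by case: hE; apply: near_regular_adj.
Qed.

(** * Newly gnostic vertices in one round *)

Definition selection_set_prob (R : realType) (V : finType) (e : rel V) (v : V)
    (A : {set V}) : R :=
  \sum_(u in A) selection_prob R e v u.

Lemma selection_prob_ge0 (R : realType) (V : finType) (e : rel V) (v u : V) :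
  0 <= selection_prob R e v u.
Proof. by rewrite /selection_prob; case: ifP => _ //; rewrite divr_ge0. Qed.

Lemma selection_set_prob_ge0 (R : realType) (V : finType) (e : rel V) (v : V)
  (A : {set V}) : 0 <= selection_set_prob R e v A.
Proof. by apply: sumr_ge0 => u _; exact: selection_prob_ge0. Qed.

Lemma selection_set_probE (R : realType) (V : finType) (e : rel V) (v : V)
    (A : {set V}) : neighbours e v != finset.set0 ->
  selection_set_prob R e v A
    = #|neighbours e v :&: A|%SET%:R / #|neighbours e v|%:R.
Proof.
move=> /negbTE v0; rewrite /selection_set_prob /selection_prob v0 -mulr_suml.
rewrite -natr_sum; congr (_%:R / _).
by rewrite -[RHS]sum1_card big_mkcond [RHS]big_mkcond; apply: eq_bigr => u _;
  rewrite finset.in_setI; do 2 case: (_ \in _).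
Qed.

Lemma sum_selection_prob (R : realType) (V : finType) (e : rel V) (v : V) :
  \sum_u selection_prob R e v u = 1.
Proof.
have [v0|v0] := eqVneq (neighbours e v) finset.set0.
  rewrite /selection_prob v0 eqxx (bigD1 v)//= eqxx big1 ?addr0// => u.
  by move=> /negbTE ->.
have := selection_set_probE R [set: V]%SET v0.
rewrite finset.setIT divff ?pnatr_eq0 ?cards_eq0// => <-.
by apply: eq_bigl => u; rewrite inE.
Qed.

(** The sum is the mean number of new gnostic vertices when all vertices select. Lower bound:
    degrees are at most [4 D] and the cut is thick. Upper bound: degrees are at least [D / 4], and
    by symmetry the cut has at most as many edges as the degree sum over [A]. *)
Lemma sum_selection_set_prob_bounds (R : realType) (V : finType) (e : rel V)
    (D : R) (A : {set V}) : near_regular e D -> 0 < D ->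
  #|A|%:R * #|~: A|%SET%:R / (16 * #|V|%:R)
    <= \sum_(v in ~: A) selection_set_prob R e v A <= 16 * #|A|%:R.
Proof.
move=> [es deg cutA] D0.
have N0 v : neighbours e v != finset.set0.
  apply/eqP => v0; have /andP[+ _] := deg v.
  by rewrite v0 finset.cards0; apply/negP; rewrite -ltNge; lra.
have d0 v : 0 < #|neighbours e v|%:R :> R.
  by rewrite ltr0n card_gt0.
apply/andP; split.
  apply: (@le_trans _ _ (\sum_(v in ~: A)
      #|neighbours e v :&: A|%SET%:R / (4 * D))); last first.
    apply: ler_sum => v _; rewrite selection_set_probE// ler_wpM2l//.
    by rewrite lef_pV2 ?posrE ?mulr_gt0//; case/andP: (deg v).
  rewrite -mulr_suml -natr_sum ler_pdivlMr ?mulr_gt0//.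
  apply: le_trans (cutA A); have [V0|V0] := posnP #|V|.
    by rewrite V0 !mulr0 invr0 !(mulr0, mul0r).
  have {V0}V0 : #|V|%:R != 0 :> R by rewrite pnatr_eq0 -lt0n.
  by rewrite le_eqVlt; apply/orP; left; apply/eqP; field.
apply: (@le_trans _ _ (\sum_(v in ~: A)
    #|neighbours e v :&: A|%SET%:R * (D / 4)^-1)).
  apply: ler_sum => v _; rewrite selection_set_probE// ler_wpM2l//.
  by rewrite lef_pV2 ?posrE ?divr_gt0//; case/andP: (deg v).
rewrite -mulr_suml -natr_sum ler_pdivrMr ?divr_gt0//.
have -> : 16 * #|A|%:R * (D / 4) = 4 * D * #|A|%:R by field.
apply: (@le_trans _ _ (\sum_(u in A) #|neighbours e u|)%N%:R).
  rewrite ler_nat; apply: (@leq_trans (\sum_v #|neighbours e v :&: A|%SET)%N).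
    by rewrite big_mkcond; apply: leq_sum => v _; case: ifP.
  rewrite (eq_bigr (fun v => \sum_(u in A) (e v u : nat))%N); last first.
    move=> v _; rewrite -sum1_card big_mkcond [RHS]big_mkcond.
    by apply: eq_bigr => u _; rewrite !inE; case: (e v u); case: (u \in A).
  rewrite exchange_big; apply: leq_sum => u _ /=.
  rewrite -sum1_card [leqRHS]big_mkcond; apply: leq_sum => v _.
  by rewrite !inE es; case: (e u v).
rewrite natr_sum (le_trans (ler_sum _ (fun u _ => proj2 (andP (deg u)))))//.
by rewrite sumr_const -[leLHS]mulr_natr.
Qed.

(* With [y = x / k]: [1 / (1 + y) <= 1 / (1 + a y) <= 1 - a y + (a y)^2], where a
   small [a] lets the linear term dominate when the second moment of [y] is at
   most a large multiple of its mean. *)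
Lemma invrD_le (R : realFieldType) (a k x : R) : 0 <= a <= 1 -> 0 < k -> 0 <= x ->
  (k + x)^-1 <= k^-1 - a * x / k ^+ 2 + (a * x) ^+ 2 / k ^+ 3.
Proof.
move=> /andP[a0 a1] k0 x0; have kx : 0 < k + x by lra.
have kn : k != 0 by rewrite gt_eqF.
rewrite -div1r ler_pdivrMr//.
(* Completing the square shows that the excess over [1] is nonnegative. *)
have -> : (k^-1 - a * x / k ^+ 2 + (a * x) ^+ 2 / k ^+ 3) * (k + x)
  = 1 + x * ((1 - a) * (k - a * x / 2) ^+ 2 + (a * x) ^+ 2 * ((3 + a) / 4)) / k ^+ 3.
  by field.
rewrite lerDl divr_ge0 ?exprn_ge0 ?(ltW k0)// mulr_ge0// addr_ge0
  ?(mulr_ge0 _ (sqr_ge0 _)) ?(mulr_ge0 (sqr_ge0 _)) ?divr_ge0//.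
  by rewrite subr_ge0.
by rewrite addr_ge0.
Qed.

(** With [a = 1 / 34], the quadratic term of [invrD_le] is in mean at most half of the linear one.
    What remains is [m / (68 k ^ 2)], and the lower bound on [m] turns it into
    [(k^-1 - n^-1) / (1088 f)], where [1088 = 68 * 16]. *)
Lemma expected_inv_drift (R : realFieldType) (U : finType) (nu : U -> R)
    (g : U -> nat) (k n f : R) :
  (forall u, 0 <= nu u) -> \sum_u nu u = 1 -> 0 < k <= n -> 0 < f ->
  \sum_u nu u * (g u)%:R ^+ 2 <= 17 * k * \sum_u nu u * (g u)%:R ->
  k * (n - k) / (16 * n * f) <= \sum_u nu u * (g u)%:R ->
  \sum_u nu u * ((k + (g u)%:R)^-1 - n^-1)
    <= (1 - (1088 * f)^-1) * (k^-1 - n^-1).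
Proof.
move=> nu0 nu1 /andP[k0 kn] f0; set m := \sum_u _ * _%:R => h2 h1.
have n0 : 0 < n by lra.
(* The maximizer of [a - 17 a^2]. *)
pose a : R := 34^-1.
apply: (@le_trans _ _ (\sum_u nu u * (k^-1 - a * (g u)%:R / k ^+ 2
   + (a * (g u)%:R) ^+ 2 / k ^+ 3 - n^-1))).
  apply: ler_sum => u _; rewrite ler_wpM2l// lerD2r invrD_le//.
  by rewrite invr_ge0 ler0n invf_le1 ?ltr0n ?ler1n.
have -> : \sum_u nu u * (k^-1 - a * (g u)%:R / k ^+ 2
     + (a * (g u)%:R) ^+ 2 / k ^+ 3 - n^-1)
   = (k^-1 - n^-1) * (\sum_u nu u) - a * m / k ^+ 2
     + a ^+ 2 * (\sum_u nu u * (g u)%:R ^+ 2) / k ^+ 3.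
  rewrite !mulr_sumr !mulr_suml -sumrB -big_split /=; apply: eq_bigr => u _.
  ring.
rewrite nu1 mulr1.
have h3 : a ^+ 2 * (\sum_u nu u * (g u)%:R ^+ 2) / k ^+ 3 <= a * m / k ^+ 2 / 2.
  rewrite ler_pdivrMr ?exprn_gt0//.
  have -> : a * m / k ^+ 2 / 2 * k ^+ 3 = a ^+ 2 * (17 * k * m).
    by rewrite /a; field; rewrite gt_eqF.
  by rewrite ler_wpM2l ?sqr_ge0.
have h4 : (1088 * f)^-1 * (k^-1 - n^-1) <= a * m / k ^+ 2 / 2.
  have -> : (1088 * f)^-1 * (k^-1 - n^-1)
      = a * (k * (n - k) / (16 * n * f)) / k ^+ 2 / 2.
    by rewrite /a; field; rewrite !gt_eqF.
  rewrite !ler_wpM2r ?invr_ge0 ?sqr_ge0 ?ler0n// ler_wpM2l// invr_ge0 ler0n//.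
rewrite mulrBl mul1r; move: h3 h4; set b := a * m / k ^+ 2; lra.
Qed.

(** Independence of the selections: the probability that all vertices of [B] select inside [A]
    factorizes. Singletons and pairs [B] give the first two moments. *)
Lemma sum_prod_ffun_in (R : realType) (V : finType) (s : V -> V -> R)
    (A B : {set V}) : (forall v, \sum_u s v u = 1) ->
  \sum_(F : {ffun V -> V}) (\prod_v s v (F v)) * (\prod_(v in B) (F v \in A)%:R)
    = \prod_(v in B) \sum_(u in A) s v u.
Proof.
move=> s1; transitivity (\prod_v \sum_u s v u * (if v \in B then (u \in A)%:R else 1)).
  rewrite bigA_distr_bigA; apply: eq_bigr => F _.
  by rewrite [X in _ * X]big_mkcond -big_split.
rewrite [RHS]big_mkcond; apply: eq_bigr => v _; case: ifP => _.
  rewrite [RHS]big_mkcond; apply: eq_bigr => u _.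
  by case: (u \in A); rewrite ?mulr1 ?mulr0.
by under eq_bigr do rewrite mulr1; exact: s1.
Qed.

Lemma hits_moment1 (R : realType) (V : finType) (s : V -> V -> R)
    (A B : {set V}) : (forall v, \sum_u s v u = 1) ->
  \sum_(F : {ffun V -> V}) (\prod_v s v (F v)) * (\sum_(v in B) (F v \in A))%N%:R
    = \sum_(v in B) \sum_(u in A) s v u.
Proof.
move=> s1; under eq_bigr do rewrite natr_sum mulr_sumr.
rewrite exchange_big; apply: eq_bigr => v _ /=.
have := sum_prod_ffun_in A [set v]%SET s1; rewrite big_set1 => <-.
by apply: eq_bigr => F _; rewrite big_set1.
Qed.

(** Expanding the square, a diagonal term is the indicator itself, with mean [q v], and an
    off-diagonal one has mean [q v * q w]. *)
Lemma hits_moment2 (R : realType) (V : finType) (s : V -> V -> R)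
    (A B : {set V}) : (forall v u, 0 <= s v u) -> (forall v, \sum_u s v u = 1) ->
  \sum_(F : {ffun V -> V})
      (\prod_v s v (F v)) * (\sum_(v in B) (F v \in A))%N%:R ^+ 2
    <= \sum_(v in B) \sum_(u in A) s v u
       + (\sum_(v in B) \sum_(u in A) s v u) ^+ 2.
Proof.
move=> s0 s1; set m := \sum_(v in B) _; pose q v := \sum_(u in A) s v u.
have q0 v : 0 <= q v by apply: sumr_ge0 => u _; exact: s0.
have -> : m + m ^+ 2 = \sum_(v in B) (q v + \sum_(w in B) q v * q w).
  rewrite big_split; congr (_ + _); rewrite expr2 mulr_suml.
  by apply: eq_bigr => v _; rewrite mulr_sumr.
under eq_bigr do rewrite natr_sum expr2 mulr_suml mulr_sumr.
rewrite exchange_big; apply: ler_sum => v vB /=.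
under eq_bigr do rewrite mulr_sumr mulr_sumr.
rewrite exchange_big (bigD1 v)//= [X in _ <= _ + X](bigD1 v)//= addrA.
apply: lerD.
  (* The right side also contains the diagonal product [q v * q v], which is dropped. *)
  apply: ler_wpDr; first exact: mulr_ge0.
  rewrite le_eqVlt; apply/orP; left; apply/eqP; rewrite {q0}/q.
  have := sum_prod_ffun_in A [set v]%SET s1; rewrite big_set1 => <-.
  by apply: eq_bigr => F _; rewrite big_set1; case: (_ \in _); rewrite ?mulr1 ?mulr0.
apply: ler_sum => w /andP[wB wv].
rewrite le_eqVlt; apply/orP; left; apply/eqP; rewrite {q0}/q.
have := sum_prod_ffun_in A [set v; w]%SET s1.
rewrite big_setU1 ?inE 1?eq_sym// big_set1 => <-.
by apply: eq_bigr => F _; rewrite big_setU1 ?inE 1?eq_sym//= big_set1.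
Qed.

(** * Markov chains driven by independent noise *)

(** A common form for both schedules: a finite state updated deterministically by i.i.d. noise of
    law [nu], with independence expressed on cylinders. *)
Definition driven_chain (d : measure_display) (Omega : measurableType d)
    (R : realType) (P : probability Omega R) (S U : finType) (nu : U -> R)
    (step : S -> U -> S) (z0 : S) (Z : nat -> Omega -> S) : Prop :=
  exists xi : nat -> Omega -> U,
    [/\ forall t, discrete_rv (xi t),
        forall (J : seq nat) (u : nat -> U), uniq J ->
          P (\bigcap_(t in [set` J]) (xi t @^-1` [set u t]))
            = (\prod_(t <- J) nu (u t))%:E,
        forall w, Z 0%N w = z0
      & forall t w, Z t.+1 w = step (Z t w) (xi t w)].

Fixpoint chain_law (R : realType) (S U : finType) (nu : U -> R)
    (step : S -> U -> S) (z0 : S) (t : nat) (z : S) : R :=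
  if t is t'.+1 then
    \sum_(x : S * U | step x.1 x.2 == z) chain_law nu step z0 t' x.1 * nu x.2
  else (z == z0)%:R.

Lemma chain_law_ge0 (R : realType) (S U : finType) (nu : U -> R)
    (step : S -> U -> S) (z0 : S) (t : nat) (z : S) :
  (forall u, 0 <= nu u) -> 0 <= chain_law nu step z0 t z.
Proof.
move=> nu0; elim: t z => [|t IH] z //=.
by apply: sumr_ge0 => x _; rewrite mulr_ge0.
Qed.

Lemma preimage_bigcup (Omega : Type) (T : finType) (D : pred T)
    (Y : Omega -> T) :
  [set w | D (Y w)] = \bigcup_(y in [set` enum D]) (Y @^-1` [set y]).
Proof.
apply/seteqP; split => [w /= Dw|w [y /=]]; first by exists (Y w) => //=; rewrite mem_enum.
by rewrite mem_enum => Dy ->.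
Qed.

Lemma discrete_measurable (d : measure_display) (Omega : measurableType d)
    (T : finType) (D : pred T) (Y : Omega -> T) :
  discrete_rv Y -> measurable [set w | D (Y w)].
Proof.
move=> mY; rewrite preimage_bigcup.
by apply: fin_bigcup_measurable => [|y _]; [exact: finite_seq | exact: mY].
Qed.

Lemma measure_discrete (d : measure_display) (Omega : measurableType d)
    (R : realType) (P : probability Omega R) (T : finType) (D : pred T)
    (Y : Omega -> T) (B : set Omega) : measurable B -> discrete_rv Y ->
  P ([set w | D (Y w)] `&` B) = (\sum_(y | D y) P (Y @^-1` [set y] `&` B))%E.
Proof.
move=> mB mY; rewrite preimage_bigcup setI_bigcupl measure_fin_bigcup.
- by rewrite -fsbig_seq ?enum_uniq// big_enum.
- exact: finite_seq.
- by move=> i j _ _ [w [[/= <- _] [/= <- _]]].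
- by move=> y _; apply: measurableI => //; exact: mY.
Qed.

Lemma discrete_rv_pair (d : measure_display) (Omega : measurableType d)
    (S T : finType) (X : Omega -> S) (Y : Omega -> T) :
  discrete_rv X -> discrete_rv Y -> discrete_rv (fun w => (X w, Y w)).
Proof.
move=> mX mY [a b].
have -> : (fun w => (X w, Y w)) @^-1` [set (a, b)] = X @^-1` [set a] `&` Y @^-1` [set b].
  by apply/seteqP; split => w /= [-> ->].
by apply: measurableI; [exact: mX | exact: mY].
Qed.

Lemma driven_chain_law (d : measure_display) (Omega : measurableType d)
    (R : realType) (P : probability Omega R) (S U : finType) (nu : U -> R)
    (step : S -> U -> S) (z0 : S) (Z : nat -> Omega -> S) (t : nat) :
  driven_chain P nu step z0 Z ->
  discrete_rv (Z t) /\
  forall z, P (Z t @^-1` [set z]) = (chain_law nu step z0 t z)%:E.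
Proof.
move=> [xi [mxi Pxi Z0 ZS]].
pose cyl (J : seq nat) u := \bigcap_(t in [set` J]) (xi t @^-1` [set u t]).
have mcyl J u : measurable (cyl J u).
  apply: fin_bigcap_measurable; first exact: finite_seq.
  by move=> i _; exact: mxi.
have preS s z : Z s.+1 @^-1` [set z]
    = [set w | [pred x : S * U | step x.1 x.2 == z] (Z s w, xi s w)].
  by apply/seteqP; split => w /=; rewrite ZS => /eqP.
have mZ s : discrete_rv (Z s).
  elim: s => [|s IH] z.
    have -> : Z 0%N @^-1` [set z] = [set _ | [pred x | x == z] z0].
      by apply/seteqP; split => w /=; rewrite Z0 => /eqP.
    have [->|nz] := eqVneq z0 z.
      by rewrite (_ : [set _ | _] = setT)// predeqE => w /=; rewrite eqxx.
    by rewrite (_ : [set _ | _] = set0)// predeqE => w /=; rewrite (negbTE nz).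
  by rewrite preS; apply/discrete_measurable/discrete_rv_pair.
split=> // z.
(* Intersecting with a cylinder of future noise carries the independence through
   the induction. *)
suff main J u : uniq J -> all (leq t) J ->
    P (Z t @^-1` [set z] `&` cyl J u)
      = (chain_law nu step z0 t z * \prod_(i <- J) nu (u i))%:E.
  (* The empty cylinder is the whole space; [point] only supplies some noise values. *)
  have := main [::] (fun i => xi i point) isT isT.
  rewrite big_nil mulr1 => <-; congr (P _).
  by apply/seteqP; split => w /= => [|[]].
elim: t z J u => [|t IH] z J u uJ tJ.
  have [->|zz] := eqVneq z z0.
    have -> : Z 0%N @^-1` [set z0] = setT.
      by apply/seteqP; split => w //= _; rewrite Z0.
    by rewrite setTI Pxi //= eqxx mul1r.
  have -> : Z 0%N @^-1` [set z] = set0.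
    by apply/seteqP; split => w //=; rewrite Z0 => /esym/eqP; rewrite (negbTE zz).
  by rewrite set0I measure0 /= (negbTE zz) mul0r.
rewrite preS (measure_discrete P _ (mcyl _ _) (discrete_rv_pair (mZ t) (mxi t))).
rewrite /= mulr_suml -sumEFin; apply: eq_bigr => -[a b] _ /=.
have tJn : t \notin J by apply/negP => /(allP tJ); rewrite ltnn.
(* The noise of round [t] joins the cylinder of later rounds, so the induction hypothesis applies to
   [t :: J]. *)
pose u' i := if i == t then b else u i.
have u'E i : i \in J -> u' i = u i.
  by rewrite /u'; case: eqVneq => // ->; rewrite (negbTE tJn).
have prodE : nu b * \prod_(i <- J) nu (u i) = \prod_(i <- t :: J) nu (u' i).
  rewrite big_cons {1}/u' eqxx; congr (_ * _).
  by apply: eq_big_seq => i iJ; rewrite u'E.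
rewrite -mulrA prodE -IH /= ?tJn ?leqnn//; last first.
  by apply: sub_all tJ => i /ltnW.
congr (P _); apply/seteqP; split => w /=.
  move=> [[-> xib] cw]; split=> // i /=; rewrite inE => /predU1P[->|iJ].
    by rewrite /u' eqxx.
  by rewrite u'E//; exact: cw.
move=> [-> cw]; split.
  by have := cw t; rewrite /= inE eqxx /u' eqxx => ->.
by move=> i iJ; have := cw i; rewrite /= inE iJ orbT u'E// => ->.
Qed.

(** Markov's inequality for a potential whose mean shrinks by [q] in each round. The drift is only
    required on the invariant [inv], outside of which the law of the chain vanishes. *)
Lemma driven_chain_expectation (d : measure_display) (Omega : measurableType d)
    (R : realType) (P : probability Omega R) (S U : finType) (nu : U -> R)
    (step : S -> U -> S) (z0 : S) (Z : nat -> Omega -> S)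
    (D : pred S) (inv : pred S) (phi : S -> R) (q c : R) (t : nat) :
  driven_chain P nu step z0 Z ->
  (forall u, 0 <= nu u) -> 0 <= q -> 0 <= c -> inv z0 ->
  (forall z u, inv z -> inv (step z u)) ->
  (forall z, inv z -> 0 <= phi z) ->
  (forall z, inv z -> D z -> 1 <= c * phi z) ->
  (forall z, inv z -> \sum_u nu u * phi (step z u) <= q * phi z) ->
  (P [set w | D (Z t w)] <= (c * q ^+ t * phi z0)%:E)%E.
Proof.
move=> chain nu0 q0 c0 inv0 invS phi0 Dphi drift.
have [mZ PZ] := driven_chain_law t chain.
pose W := chain_law nu step z0.
have W0 s z : 0 <= W s z by exact: chain_law_ge0.
have Winv s z : ~~ inv z -> W s z = 0.
  elim: s z => [|s IH] z iz /=.
    by rewrite /W /=; case: (eqVneq z z0) iz => // ->; rewrite inv0.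
  rewrite /W /= big1// => -[a b] /= /eqP ez; have [ia|ia] := boolP (inv a).
    by move: iz; rewrite -ez invS.
  by rewrite -/W IH// mul0r.
have -> : P [set w | D (Z t w)] = (\sum_(z | D z) W t z)%:E.
  rewrite -[X in P X]setIT measure_discrete//.
  by rewrite -sumEFin; apply: eq_bigr => z _; rewrite setIT PZ.
rewrite lee_fin -mulrA.
have decay s : \sum_z W s z * phi z <= q ^+ s * phi z0.
  elim: s => [|s IH].
    rewrite expr0 mul1r (bigD1 z0)//= /W /= eqxx mul1r big1 ?addr0// => z /negbTE ->.
    by rewrite mul0r.
  rewrite exprS -mulrA; apply: le_trans (ler_wpM2l q0 IH).
  rewrite mulr_sumr.
  have -> : \sum_z W s.+1 z * phi z
      = \sum_z W s z * \sum_u nu u * phi (step z u).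
    transitivity (\sum_(x : S * U) W s x.1 * nu x.2 * phi (step x.1 x.2)).
      rewrite (partition_big (fun x => step x.1 x.2) xpredT)//=.
      apply: eq_bigr => z _; rewrite mulr_suml.
      by apply: eq_bigr => x /eqP ->.
    rewrite -(pair_bigA _ (fun z u => W s z * nu u * phi (step z u))) /=.
    by apply: eq_bigr => z _; rewrite mulr_sumr; apply: eq_bigr => u _; rewrite mulrA.
  apply: ler_sum => z _; have [iz|iz] := boolP (inv z).
    by rewrite mulrCA ler_wpM2l// drift.
  by rewrite Winv// !mul0r mulr0.
apply: le_trans (ler_wpM2l c0 (decay t)); rewrite mulr_sumr big_mkcond /=.
apply: ler_sum => z _; rewrite mulrCA.
have [iz|iz] := boolP (inv z); last by rewrite Winv// mul0r; case: ifP.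
case: ifPn => [Dz|_]; first by rewrite ler_peMr// Dphi.
by rewrite !mulr_ge0// phi0.
Qed.

(** * The agnostic time *)

Definition gnostic (V : finType) (C : Type) (x : V -> option C) : {set V} :=
  [set v | isSome (x v)]%SET.

Lemma gnostic_setT (V : finType) (C : Type) (x : V -> option C) :
  gnostic x = [set: V]%SET <-> forall v, x v <> None.
Proof.
split=> [/setP h v xv|h]; first by have := h v; rewrite !inE xv.
by apply/setP => v; rewrite !inE; case: (x v) (h v).
Qed.

(** Each round before the first one without agnostic vertices contributes [1]; if there is no such
    round, the series diverges. *)
Lemma agnostic_time_le_sum (R : realType) (Omega : Type) (V : finType) (C : Type)
    (X : nat -> Omega -> V -> option C) (w : Omega) :
  (agnostic_time R X w
    <= \sum_(0 <= t <oo) (gnostic (X t w) != [set: V]%SET)%:R%:E)%E.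
Proof.
pose u t : \bar R := (gnostic (X t w) != [set: V]%SET)%:R%:E.
rewrite [leRHS](_ : _ = \sum_(0 <= t <oo) u t)%E//.
have u0 t : (0 <= u t)%E by rewrite /u lee_fin.
have partial N : (forall t, (t < N)%N -> gnostic (X t w) != [set: V]%SET) ->
    (N%:R%:E <= \sum_(0 <= t <oo) u t)%E.
  move=> hN; apply: le_trans (nneseries_lim_ge N (fun t _ _ => u0 t)).
  rewrite big_nat (eq_bigr (fun=> 1%:E)); last by move=> t /andP[_ /hN]; rewrite /u => ->.
  by rewrite -big_nat sumEFin sumr_const_nat subn0.
have [[t ht]|no] := pselect (exists t, gnostic (X t w) == [set: V]%SET).
  have ex : exists t, gnostic (X t w) == [set: V]%SET by exists t.
  case: (ex_minnP ex) => m /eqP hm mmin.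
  apply: (@le_trans _ _ m%:R%:E).
    by apply: ereal_inf_lbound; exists m => //=; apply/gnostic_setT.
  apply: partial => s sm; apply/negP => /mmin; by rewrite leqNgt sm.
suff -> : (\sum_(0 <= t <oo) u t = +oo)%E by rewrite leey.
apply: eq_infty => r; have [r0|r0] := leP r 0.
  by apply: le_trans (nneseries_ge0 _) => //; rewrite lee_fin.
apply: le_trans (partial (Num.truncn r).+1 _); last first.
  by move=> t _; apply/negP => h; apply: no; exists t.
by rewrite lee_fin ltW// truncnS_gt.
Qed.

(** The integral of a nonnegative function is a supremum over the simple functions below it, which
    is monotone for arbitrary functions. This bounds [agnostic_time] without a proof of its
    measurability. *)
Lemma ge0_le_integralT (d : measure_display) (Omega : measurableType d)
    (R : realType) (mu : measure Omega R) (f g : Omega -> \bar R) :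
  (forall w, 0 <= f w)%E -> (forall w, f w <= g w)%E ->
  (\int[mu]_w f w <= \int[mu]_w g w)%E.
Proof.
move=> f0 fg; rewrite !ge0_integralTE//; last by move=> w; apply: le_trans (fg w).
by apply: le_ereal_sup => _ [h /= hf <-]; exists h => //= w; apply: le_trans (fg w).
Qed.

Lemma integral_agnostic_time_le (d : measure_display) (Omega : measurableType d)
    (R : realType) (P : probability Omega R) (V : finType) (C : Type)
    (X : nat -> Omega -> V -> option C) (b : nat -> R) (B : R) :
  (forall t, measurable [set w | gnostic (X t w) != [set: V]%SET]) ->
  (forall t, P [set w | gnostic (X t w) != [set: V]%SET] <= (b t)%:E)%E ->
  (forall N, \sum_(t < N) b t <= B) ->
  (\int[P]_w agnostic_time R X w <= B%:E)%E.
Proof.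
move=> mA PA sumb; pose A t := [set w | gnostic (X t w) != [set: V]%SET].
have TA w : (agnostic_time R X w <= \sum_(0 <= t <oo) (\1_(A t) w)%:E)%E.
  apply: le_trans (agnostic_time_le_sum R X w) _.
  apply: lee_nneseries => t _; first by rewrite lee_fin.
  by rewrite indicE; case: (boolP (gnostic _ != _)) => h; rewrite lee_fin// mem_set.
apply: le_trans (ge0_le_integralT P _ TA) _.
  by move=> w; apply: le_ereal_inf_tmp => _ [t _ <-]; rewrite lee_fin.
rewrite integral_nneseries//; last first.
  by move=> t; apply/measurable_EFinP/measurable_indic/mA.
apply: lime_le.
  by apply: is_cvg_nneseries => t _ _; apply: integral_ge0 => w _; rewrite lee_fin.
apply: nearW => N; apply: (@le_trans _ _ (\sum_(0 <= t < N) (b t)%:E)%E).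
  by apply: lee_sum => t _; rewrite integral_indic ?setIT//; [exact: PA | exact: mA].
by rewrite sumEFin lee_fin big_mkord.
Qed.

(** The terms before [t0] are bounded by [1], the later ones by a geometric series that starts below
    [1]. *)
Lemma sum_minr_geometric (R : realType) (M q : R) (t0 N : nat) :
  0 <= q < 1 -> M * q ^+ t0 <= 1 ->
  \sum_(t < N) Num.min 1 (M * q ^+ t) <= t0%:R + (1 - q)^-1.
Proof.
move=> /andP[q0 q1] Mq.
have geo n : \sum_(s < n) q ^+ s <= (1 - q)^-1.
  have := subrX1 q n; have := exprn_ge0 n q0; have q1' : 0 < 1 - q by lra.
  rewrite -[_^-1]mul1r ler_pdivlMr//; nra.
have [Nt|tN] := leqP N t0.
  apply: ler_wpDr; first by rewrite invr_ge0; lra.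
  apply: (@le_trans _ _ (\sum_(t < N) 1)).
    by apply: ler_sum => t _; rewrite ge_min lexx.
  by rewrite sumr_const card_ord ler_nat.
rewrite -(big_mkord xpredT (fun t => Num.min 1 (M * q ^+ t))).
rewrite (big_cat_nat (leq0n t0) (ltnW tN)) /=; apply: lerD.
  apply: (@le_trans _ _ (\sum_(0 <= t < t0) 1)).
    by apply: ler_sum => t _; rewrite ge_min lexx.
  by rewrite sumr_const_nat subn0.
apply: le_trans (geo (N - t0)%N).
rewrite -{1}(add0n t0) big_addn big_mkord; apply: ler_sum => s _.
rewrite ge_min; apply/orP; right; rewrite exprD mulrCA ler_piMr ?exprn_ge0//.
Qed.

(** The tails are at most [n ^ 2 (1 - 1 / kappa) ^ t], which drops below [1] after about
    [2 kappa ln n] rounds. The remaining geometric series adds [kappa], and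
    [1 + kappa <= 2 kappa ln n] gives the factor [4]. *)
Lemma integral_agnostic_time_chain (d : measure_display)
    (Omega : measurableType d) (R : realType) (P : probability Omega R)
    (V U : finType) (C : Type) (nu : U -> R) (step : {set V} -> U -> {set V})
    (A0 : {set V}) (X : nat -> Omega -> V -> option C) (kappa : R) :
  driven_chain P nu step A0 (fun t w => gnostic (X t w)) ->
  (forall u, 0 <= nu u) -> A0 != finset.set0 ->
  (forall (A : {set V}) u, A \subset step A u) -> 1 <= kappa ->
  (forall A : {set V}, A != finset.set0 ->
     \sum_u nu u * (#|step A u|%:R^-1 - #|V|%:R^-1)
       <= (1 - kappa^-1) * (#|A|%:R^-1 - #|V|%:R^-1)) ->
  1 <= ln #|V|%:R :> R ->
  (\int[P]_w agnostic_time R X w <= (4 * kappa * ln #|V|%:R)%:E)%E.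
Proof.
move=> chain nu0 A00 sub k1 drift ln1.
have k0 : 0 < kappa by lra.
have ik : 0 < kappa^-1 <= 1 by rewrite invr_gt0 k0 invf_le1.
have V0 : 0 < #|V|%:R :> R.
  by rewrite ltNge; apply/negP => /ln0 h; lra.
pose n : R := #|V|%:R; pose q : R := 1 - kappa^-1.
have q01 : 0 <= q < 1 by rewrite /q; lra.
have mT t : measurable [set w | gnostic (X t w) != [set: V]%SET].
  have [m _] := driven_chain_law t chain.
  exact: (@discrete_measurable _ _ _ (fun A : {set V} => A != [set: V]%SET) _ m).
have card1 (A : {set V}) : A != finset.set0 -> 1 <= #|A|%:R :> R.
  by rewrite ler1n card_gt0.
have cardn (A : {set V}) : #|A|%:R <= n by rewrite ler_nat max_card.
have PT t : (P [set w | gnostic (X t w) != [set: V]%SET]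
    <= (Num.min 1 (n ^+ 2 * q ^+ t))%:E)%E.
  rewrite /Num.min; case: ifP => _; first exact: probability_le1.
  (* Nonemptiness is the invariant: since [0^-1 = 0], the potential of the empty set would be
     negative. *)
  have := @driven_chain_expectation _ _ _ P _ _ nu step A0 _
    (fun A : {set V} => A != [set: V]%SET) (fun A : {set V} => A != finset.set0)
    (fun A : {set V} => #|A|%:R^-1 - n^-1) q (n ^+ 2) t chain nu0.
  have q0 : 0 <= q by lra.
  move=> /(_ q0 (sqr_ge0 _) A00 _ _ _ _)/le_trans; apply.
  - move=> A u A1; apply: contraNneq A1 => A2.
    by rewrite -finset.subset0 -A2.
  - move=> A /card1 A1; rewrite subr_ge0 lef_pV2 ?posrE//; lra.
  - move=> A /card1 A1 AT.
    have An : 1 <= n - #|A|%:R.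
      rewrite -natrB ?max_card// ler1n subn_gt0 -cardsT proper_card//.
      by rewrite finset.properT.
    (* At least one vertex is missing from [A], so this is at least [n / #|A| >= 1]. *)
    have -> : n ^+ 2 * (#|A|%:R^-1 - n^-1) = n * (n - #|A|%:R) / #|A|%:R.
      by field; rewrite !gt_eqF//; lra.
    rewrite ler_pdivlMr; last lra.
    have := cardn A; nra.
  - exact: drift.
  rewrite lee_fin ler_piMr ?mulr_ge0 ?exprn_ge0 ?sqr_ge0//.
  have : #|A0|%:R^-1 <= 1 :> R by rewrite invf_le1 ?card1//;
    apply: lt_le_trans (card1 _ A00).
  have : 0 < n^-1 by rewrite invr_gt0.
  lra.
pose L : R := ln n; pose t0 := (Num.truncn (2 * kappa * L)).+1.
have L1 : 1 <= L by [].
have t0lo : 2 * kappa * L <= t0%:R by rewrite ltW// truncnS_gt.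
have t0hi : t0%:R <= 2 * kappa * L + 1.
  rewrite /t0 -natr1 lerD2r truncn_le; nra.
have Mq : n ^+ 2 * q ^+ t0 <= 1.
  have -> : n ^+ 2 = expR (2 * L) by rewrite mulrC expRM_natr lnK// posrE.
  apply: (@le_trans _ _ (expR (2 * L) * expR (- kappa^-1 * t0%:R))).
    rewrite ler_wpM2l ?expR_ge0// expRM_natr lerXn2r ?nnegrE ?expR_ge0//; first lra.
    exact: expR_ge1Dx.
  rewrite -expRD -[leRHS]expR0 ler_expR mulNr subr_le0 [leRHS]mulrC ler_pdivlMr//.
  lra.
apply: integral_agnostic_time_le mT PT _ => N.
apply: le_trans (sum_minr_geometric N q01 Mq) _.
have -> : 1 - q = kappa^-1 by rewrite /q subKr.
rewrite invrK; apply: le_trans (lerD t0hi (lexx _)) _.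
have kL : kappa <= kappa * L by rewrite ler_peMr// ltW.
rewrite -/n -/L; clear -k1 kL; lra.
Qed.

(** * The gnostic set under the two schedules *)

Lemma gnostic_pull (V : finType) (C : Type) (x : V -> option C) (v u : V) :
  isSome (pull x v u) = (u \in gnostic x) || (v \in gnostic x).
Proof. by rewrite /pull !inE; case: (x u). Qed.

(** Colours do not influence which vertices become gnostic, so the gnostic set is a chain by itself.
    The noise of a round is the function of all selections; its law is a product because the
    [S (t, v)] are independent over all pairs. *)
Lemma synchronous_driven_chain (d : measure_display) (Omega : measurableType d)
    (R : realType) (P : probability Omega R) (V : finType) (C : Type)
    (e : rel V) (x0 : V -> option C) (X : nat -> Omega -> V -> option C) :
  synchronous_voter P e x0 X ->
  driven_chain P (fun F : {ffun V -> V} => \prod_v selection_prob R e v (F v))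
    (fun (A : {set V}) F => A :|: [set v | F v \in A])%SET (gnostic x0)
    (fun t w => gnostic (X t w)).
Proof.
move=> [S [mS indS PS X0 XS]]; exists (fun t w => [ffun v => S (t, v) w]).
have pre t (F : {ffun V -> V}) :
    (fun w => [ffun v => S (t, v) w]) @^-1` [set F]
      = \bigcap_(v in [set` enum V]) (S (t, v) @^-1` [set F v]).
  apply/seteqP; split => [w /= <- v _|w /= h] /=; first by rewrite ffunE.
  by apply/ffunP => v; rewrite ffunE; apply: h; rewrite /= mem_enum.
split.
- move=> t F; rewrite pre; apply: fin_bigcap_measurable; first exact: finite_seq.
  by move=> v _; exact: mS.
- move=> J u uJ.
  have -> : \bigcap_(t in [set` J]) ((fun w => [ffun v => S (t, v) w]) @^-1` [set u t])
      = \bigcap_(i in [set` [seq (t, v) | t <- J, v <- enum V]])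
          (S i @^-1` [set u i.1 i.2]).
    apply/seteqP; split => w h.
      move=> i /= /allpairsP[[t v] /= [tJ vV ->]].
      by have := h t tJ; rewrite pre; apply.
    move=> t tJ; rewrite pre => v vV; apply: (h (t, v)).
    by apply/allpairsP; exists (t, v).
  rewrite (indS _ (fun i => [set u i.1 i.2])); last first.
    by rewrite allpairs_uniq ?enum_uniq// => -[a b] [a' b'] _ _ [-> ->].
  rewrite big_allpairs -prodEFin; apply: eq_bigr => t _.
  by rewrite big_enum -prodEFin; apply: eq_bigr => v _; rewrite PS.
- by move=> w; apply/setP => v; rewrite !inE X0.
- by move=> t w; apply/setP => v; rewrite !inE XS gnostic_pull !inE ffunE orbC.
Qed.

Lemma asynchronous_driven_chain (d : measure_display) (Omega : measurableType d)
    (R : realType) (P : probability Omega R) (V : finType) (C : Type)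
    (e : rel V) (x0 : V -> option C) (X : nat -> Omega -> V -> option C) :
  asynchronous_voter P e x0 X ->
  driven_chain P (fun x : V * V => #|V|%:R^-1 * selection_prob R e x.1 x.2)
    (fun (A : {set V}) x => if x.2 \in A then x.1 |: A else A)%SET (gnostic x0)
    (fun t w => gnostic (X t w)).
Proof.
move=> [S [mS indS PS X0 XS]]; exists S; split => //.
- move=> J u uJ; rewrite (indS J (fun t => [set u t]))// -prodEFin.
  by apply: eq_bigr => t _; rewrite [u t]surjective_pairing PS.
- by move=> w; apply/setP => v; rewrite !inE X0.
- move=> t w; apply/setP => v; rewrite [LHS]inE XS.
  case: eqVneq => [->|nv]; rewrite ?gnostic_pull !inE.
    by case: ifP; rewrite !inE ?eqxx.
  by case: ifP; rewrite !inE ?(negbTE nv).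
Qed.

Lemma card_setU_hits (V : finType) (A : {set V}) (F : V -> V) :
  #|A :|: [set v | F v \in A]|%SET = (#|A| + \sum_(v in ~: A) (F v \in A))%N.
Proof.
rewrite -!sum1_card big_mkcond [X in (X + _)%N]big_mkcond [X in (_ + X)%N]big_mkcond.
rewrite -big_split /=; apply: eq_bigr => v _; rewrite !inE.
by case: (v \in A); case: (F v \in A).
Qed.

Lemma synchronous_drift (R : realType) (V : finType) (e : rel V) (D : R)
    (A : {set V}) : near_regular e D -> 0 < D -> A != finset.set0 ->
  \sum_(F : {ffun V -> V}) (\prod_v selection_prob R e v (F v))
      * (#|A :|: [set v | F v \in A]|%SET%:R^-1 - #|V|%:R^-1)
    <= (1 - (1088 * 1)^-1) * (#|A|%:R^-1 - #|V|%:R^-1).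
Proof.
move=> reg D0 A0; under eq_bigr do rewrite card_setU_hits natrD.
have s0 := selection_prob_ge0 R e; have s1 := sum_selection_prob R e.
have A1 : 1 <= #|A|%:R :> R by rewrite ler1n card_gt0.
have /andP[mlo mhi] := sum_selection_set_prob_bounds A reg D0.
have m1 := hits_moment1 A (~: A)%SET s1.
have m2 := hits_moment2 A (~: A)%SET s0 s1.
apply: expected_inv_drift => //.
- by move=> F; apply: prodr_ge0.
- by rewrite -(bigA_distr_bigA (selection_prob R e)) big1.
- by rewrite ler_nat max_card andbT; lra.
(* From [m <= 16 #|A|] and [1 <= #|A|] follows [m + m ^ 2 <= 17 #|A| m]. *)
- apply: le_trans m2 _; rewrite m1; set m := \sum_(v in _) _.
  have m0 : 0 <= m by apply: sumr_ge0 => v _; exact: selection_set_prob_ge0.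
  have {}mhi : m <= 16 * #|A|%:R by [].
  clear -A1 m0 mhi; nra.
- rewrite m1 mulr1; apply: le_trans mlo.
  by rewrite -natrB ?max_card// -(cardsC A) addKn.
Qed.

Lemma card_setU1_hit (V : finType) (A : {set V}) (x : V * V) :
  #|(if x.2 \in A then x.1 |: A else A)%SET|
    = (#|A| + ((x.1 \notin A) && (x.2 \in A)))%N.
Proof.
case: ifP => _; last by rewrite andbF addn0.
by rewrite cardsU1 andbT addnC.
Qed.

(** At most one vertex changes, so the increment equals its square and the second moment is the
    mean. This mean is the synchronous one divided by [#|V|], whence the scale [f = #|V|]. *)
Lemma asynchronous_drift (R : realType) (V : finType) (e : rel V) (D : R)
    (A : {set V}) : near_regular e D -> 0 < D -> A != finset.set0 ->
  \sum_(x : V * V) #|V|%:R^-1 * selection_prob R e x.1 x.2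
      * (#|(if x.2 \in A then x.1 |: A else A)%SET|%:R^-1 - #|V|%:R^-1)
    <= (1 - (1088 * #|V|%:R)^-1) * (#|A|%:R^-1 - #|V|%:R^-1).
Proof.
move=> reg D0 A0; under eq_bigr do rewrite card_setU1_hit natrD.
have s0 := selection_prob_ge0 R e; have s1 := sum_selection_prob R e.
have A1 : 1 <= #|A|%:R :> R by rewrite ler1n card_gt0.
have /andP[mlo mhi] := sum_selection_set_prob_bounds A reg D0.
have AV : #|A|%:R <= #|V|%:R :> R by rewrite ler_nat max_card.
have V0 : 0 < #|V|%:R :> R by lra.
have m1 : \sum_(x : V * V) #|V|%:R^-1 * selection_prob R e x.1 x.2
      * ((x.1 \notin A) && (x.2 \in A))%:R
    = #|V|%:R^-1 * \sum_(v in ~: A) selection_set_prob R e v A.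
  rewrite mulr_sumr big_mkcond [RHS]big_mkcond -(pair_bigA _ (fun v u =>
    #|V|%:R^-1 * selection_prob R e v u * ((v \notin A) && (u \in A))%:R)) /=.
  apply: eq_bigr => v _; rewrite inE; case: (v \notin A) => /=; last first.
    by rewrite big1// => u _; rewrite mulr0.
  rewrite /selection_set_prob mulr_sumr [RHS]big_mkcond; apply: eq_bigr => u _.
  by case: (u \in A); rewrite ?mulr1 ?mulr0.
apply: expected_inv_drift => //.
- by move=> x; rewrite mulr_ge0 ?invr_ge0.
- rewrite -(pair_bigA _ (fun v u => #|V|%:R^-1 * selection_prob R e v u)) /=.
  under eq_bigr do rewrite -mulr_sumr s1 mulr1.
  by rewrite sumr_const -[LHS]mulr_natr mulVf// gt_eqF.
- by rewrite AV andbT; lra.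
- under eq_bigr do rewrite -natrX expnS expn1 mulnb andbb.
  rewrite m1 ler_peMl//; last lra.
  by rewrite mulr_ge0 ?invr_ge0// sumr_ge0// => v _; exact: selection_set_prob_ge0.
- rewrite m1 [leRHS]mulrC ler_pdivlMr//.
  apply: le_trans mlo; rewrite -natrB ?max_card// -{1}(cardsC A) addKn.
  by rewrite le_eqVlt; apply/orP; left; apply/eqP; field; rewrite gt_eqF.
Qed.

(** * Expected time on near-regular graphs and on the random graph *)

Lemma near_regular_expected_time (R : realType) (C : Type) (s : schedule)
    (V : finType) (e : rel V) (D : R) :
  near_regular e D -> 0 < D -> 1 <= ln #|V|%:R :> R ->
  expected_agnostic_time_le s C e
    (4 * 1088 * (time_scale R s #|V| * ln #|V|%:R)).
Proof.
move=> reg D0 ln1 d Omega P x0 X [v xv].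
have g0 : gnostic x0 != finset.set0.
  by apply/set0Pn; exists v; rewrite inE; case: (x0 v) xv.
have V1 : 1 <= #|V|%:R :> R by rewrite ler1n; apply/card_gt0P; exists v.
rewrite -mulrA [1088 * _]mulrA mulrA.
case: s => [/synchronous_driven_chain|/asynchronous_driven_chain] chain.
  apply: (integral_agnostic_time_chain chain) => //.
  - by move=> F; apply: prodr_ge0 => u _; exact: selection_prob_ge0.
  - by move=> A F; exact: finset.subsetUl.
  - by rewrite /=; lra.
  - by move=> A; exact: synchronous_drift reg D0.
apply: (integral_agnostic_time_chain chain) => //.
- by move=> x; rewrite mulr_ge0 ?invr_ge0// selection_prob_ge0.
- by move=> A x; case: ifP => // _; exact: finset.subsetUr.
- by rewrite /=; lra.
- by move=> A; exact: asynchronous_drift reg D0.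
Qed.

Theorem proposition6 (R : realType) (C : Type) (s : schedule) (p : nat -> R)
    (hp : forall n : nat, (0 < n)%N -> 0 < p n <= 1)
    (hlog : (p n * n%:R / ln (n%:R : R)) @[n --> \oo] --> +oo) :
  exists K : R,
    gnp_prob (p n) (fun E : {set {set 'I_n}} =>
      expected_agnostic_time_le s C (adj E)
        (K * (time_scale R s n * ln (n%:R : R))))
      @[n --> \oo] --> (1 : R).
Proof.
(* The drift gives [kappa = 1088 f(n)], and summing the tails gives the factor [4]. *)
exists (4 * 1088).
have lim1 : (fun n => 1 - 5 / n%:R : R) n @[n --> \oo] --> (1 : R).
  rewrite -cvg_shiftS.
  suff : 1 - 5 * n.+1%:R^-1 @[n --> \oo] --> (1 - 5 * 0 : R) by rewrite mulr0 subr0.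
  apply: cvgB; first exact: cvg_cst.
  by apply: cvgM; [exact: cvg_cst | exact: cvg_harmonic].
apply: (squeeze_cvgr _ lim1 (cvg_cst (1 : R))).
(* Only the threshold [16] of [gnp_prob_near_regular] is extracted from the divergence. *)
move/cvgryPge : hlog => /(_ 16) hlog.
near=> n.
(* Since [expR 1 <= 4], this ensures [1 <= ln n]. *)
have n4 : (4 <= n)%N by near: n; exact: nbhs_infty_ge.
have n0 : (0 < n)%N by apply: leq_trans n4.
have /andP[p0 p1] := hp _ n0.
have p01 : 0 <= p n <= 1 by rewrite ltW.
have ln1 : 1 <= ln n%:R :> R.
  rewrite -[leLHS]expRK ler_ln ?posrE ?expR_gt0 ?ltr0n//.
  by apply: le_trans (expR1_le4 R) _; rewrite ler_nat.
have pn : 16 * ln n%:R <= p n * n%:R.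
  by rewrite -ler_pdivlMr; [near: n | lra].
have D0 : 0 < p n * n.-1%:R by rewrite mulr_gt0// ltr0n -ltnS prednK// (leq_trans _ n4).
apply/andP; split; last first.
  have := gnp_prob_compl (p n) (fun E : {set {set 'I_n}} =>
      expected_agnostic_time_le s C (adj E)
        (4 * 1088 * (time_scale R s n * ln (n%:R : R)))).
  have := gnp_prob_ge0 (fun E : {set {set 'I_n}} => ~
      expected_agnostic_time_le s C (adj E)
        (4 * 1088 * (time_scale R s n * ln (n%:R : R)))) p01.
  rewrite /cst; lra.
apply: le_trans (gnp_prob_near_regular _ p01 pn) _; first exact: leq_trans n4.
apply: gnp_prob_mono => // E _ reg.
have := @near_regular_expected_time R C s _ _ _ reg D0.
by rewrite card_ord; apply.
Unshelve. all: by end_near.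
Qed.
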